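(* Let $w=(w(n))_{n\in\mathbb{N}}$ be a bounded, strictly positive sequence such that $\mathsf{C}^{(1,w)}\in\mathcal{L}(\ell_1(w))$. If $\mathsf{C}^{(1,w)}$ is Cesàro bounded, then necessarily $w\in\ell_1$. In particular, this is the case whenever $\mathsf{C}^{(1,w)}$ is power bounded or mean ergodic.
   Context: The discrete Cesàro operator $\mathsf{C}\colon\mathbb{C}^{\mathbb{N}}\to\mathbb{C}^{\mathbb{N}}$ is the linear map $\mathsf{C}x:=\left(\frac{x_1+\dots+x_n}{n}\right)_{n\in\mathbb{N}}$ for $x=(x_n)_{n\in\mathbb{N}}$, with $\mathbb{N}=\{1,2,\dots\}$. For a bounded, strictly positive sequence $w$, $\ell_1(w):=\{x\in\mathbb{C}^{\mathbb{N}}\colon \sum_{n=1}^\infty w(n)|x_n|<\infty\}$, a Banach space for the norm $\|x\|_{1,w}:=\sum_{n=1}^\infty w(n)|x_n|$. $\mathcal{L}(X)$ is the space of continuous linear operators on a Banach space $X$. Writing $\mathsf{C}^{(1,w)}\in\mathcal{L}(\ell_1(w))$ means that $\mathsf{C}$ maps $\ell_1(w)$ continuously into itself, and $\mathsf{C}^{(1,w)}$ denotes the restriction of $\mathsf{C}$ to $\ell_1(w)$. For $T\in\mathcal{L}(X)$ let $T_{[n]}:=\frac1n\sum_{m=1}^nT^m$, $n\in\mathbb{N}$. $T$ is power bounded if $\sup_n\|T^n\|<\infty$; Cesàro bounded if $\sup_n\|T_{[n]}\|<\infty$; mean ergodic if there is $P\in\mathcal{L}(X)$ with $\lim_{n\to\infty}T_{[n]}x=Px$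 for each $x\in X$. *)

(* Defs.v *)
From Stdlib Require Import Reals Lra.
From Stdlib Require Import FunctionalExtensionality ProofIrrelevance.
From Coquelicot Require Import Coquelicot.

(* Sequences (x_1, x_2, ...) are functions on nat with the index shifted by
   one: [x n] is the coordinate x_(n+1), and likewise for weights. *)

Open Scope R_scope.

Record weight : Type := Weight {
  wt :> nat -> R;
  wt_pos : forall n, 0 < wt n;
  wt_bounded : exists M, forall n, wt n <= M
}.

Definition in_l1w (w : nat -> R) (x : nat -> C) : Prop :=
  ex_series (fun n => w n * Cmod (x n)).

Definition norm_l1w (w : nat -> R) (x : nat -> C) : R :=
  Series (fun n => w n * Cmod (x n)).

(* Membership of a real sequence in the unweighted complex space. *)
Definition in_l1 (u : nat -> R) : Prop :=
  in_l1w (fun _ => 1) (fun n => RtoC (u n)).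

Section WeightedL1.

Context (w : weight).

Definition l1w : Type := {x : nat -> C | in_l1w w x}.

Definition coord (x : l1w) : nat -> C := proj1_sig x.

Lemma l1w_eq (x y : l1w) : (forall n, coord x n = coord y n) -> x = y.
Proof.
destruct x as [x Hx], y as [y Hy]; unfold coord; simpl; intros H.
assert (E : x = y) by (apply functional_extensionality; exact H).
subst y; f_equal; apply proof_irrelevance.
Qed.

Lemma wterm_ge0 (x : nat -> C) n : 0 <= w n * Cmod (x n).
Proof.
apply Rmult_le_pos; [apply Rlt_le, wt_pos | apply Cmod_ge_0].
Qed.

Lemma wterm_triangle (x y : nat -> C) n :
  w n * Cmod (Cplus (x n) (y n)) <= w n * Cmod (x n) + w n * Cmod (y n).
Proof.
rewrite <- Rmult_plus_distr_l.
apply Rmult_le_compat_l; [apply Rlt_le, wt_pos | apply Cmod_triangle].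
Qed.

Lemma in_l1w_zero : in_l1w w (fun _ => RtoC 0).
Proof.
exists 0. apply is_series_ext with (a := fun _ => 0).
  intros n; rewrite Cmod_0; symmetry; apply Rmult_0_r.
apply filterlim_ext with (f := fun _ : nat => 0).
  intros n; rewrite sum_n_const; symmetry; apply Rmult_0_r.
apply filterlim_const.
Qed.

Lemma in_l1w_plus x y :
  in_l1w w x -> in_l1w w y -> in_l1w w (fun n => Cplus (x n) (y n)).
Proof.
intros Hx Hy.
apply (@ex_series_le R_AbsRing R_CompleteNormedModule)
  with (b := fun n => w n * Cmod (x n) + w n * Cmod (y n)).
  intros n. unfold norm; simpl; unfold abs; simpl.
  rewrite Rabs_pos_eq by apply (wterm_ge0 (fun n => Cplus (x n) (y n))).
  apply wterm_triangle.
exact (ex_series_plus _ _ Hx Hy).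
Qed.

Lemma in_l1w_scal a x : in_l1w w x -> in_l1w w (fun n => Cmult a (x n)).
Proof.
intros Hx.
apply ex_series_ext with (a := fun n => Cmod a * (w n * Cmod (x n))).
  intros n; change (Cmod a * (w n * Cmod (x n)) = w n * Cmod (Cmult a (x n))).
  rewrite Cmod_mult; ring.
exact (ex_series_scal_l (Cmod a) _ Hx).
Qed.

Lemma in_l1w_opp x : in_l1w w x -> in_l1w w (fun n => Copp (x n)).
Proof.
apply ex_series_ext; intros n; now rewrite Cmod_opp.
Qed.

Definition l1w_zero : l1w := exist _ _ in_l1w_zero.
Definition l1w_plus (x y : l1w) : l1w :=
  exist _ _ (in_l1w_plus _ _ (proj2_sig x) (proj2_sig y)).
Definition l1w_opp (x : l1w) : l1w := exist _ _ (in_l1w_opp _ (proj2_sig x)).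
Definition l1w_scal (a : C) (x : l1w) : l1w :=
  exist _ _ (in_l1w_scal a _ (proj2_sig x)).

Lemma l1w_plus_comm x y : l1w_plus x y = l1w_plus y x.
Proof. apply l1w_eq; intros n; apply Cplus_comm. Qed.

Lemma l1w_plus_assoc x y z :
  l1w_plus x (l1w_plus y z) = l1w_plus (l1w_plus x y) z.
Proof. apply l1w_eq; intros n; apply Cplus_assoc. Qed.

Lemma l1w_plus_zero x : l1w_plus x l1w_zero = x.
Proof. apply l1w_eq; intros n; apply Cplus_0_r. Qed.

Lemma l1w_plus_opp x : l1w_plus x (l1w_opp x) = l1w_zero.
Proof. apply l1w_eq; intros n; apply Cplus_opp_r. Qed.

Definition l1w_AbelianMonoid_mixin :=
  AbelianMonoid.Mixin l1w l1w_plus l1w_zero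
    l1w_plus_comm l1w_plus_assoc l1w_plus_zero.

Canonical l1w_AbelianMonoid :=
  AbelianMonoid.Pack l1w l1w_AbelianMonoid_mixin l1w.

Definition l1w_AbelianGroup_mixin :=
  AbelianGroup.Mixin l1w_AbelianMonoid l1w_opp l1w_plus_opp.

Canonical l1w_AbelianGroup :=
  AbelianGroup.Pack l1w
    (AbelianGroup.Class _ l1w_AbelianMonoid_mixin l1w_AbelianGroup_mixin) l1w.

Lemma l1w_scal_assoc (a b : C_Ring) (x : l1w_AbelianGroup) :
  l1w_scal a (l1w_scal b x) = l1w_scal (mult a b) x.
Proof. apply l1w_eq; intros n; apply Cmult_assoc. Qed.

Lemma l1w_scal_one (x : l1w_AbelianGroup) : l1w_scal (@one C_Ring) x = x.
Proof. apply l1w_eq; intros n; apply Cmult_1_l. Qed.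

Lemma l1w_scal_distr_l (a : C_Ring) (x y : l1w_AbelianGroup) :
  l1w_scal a (plus x y) = plus (l1w_scal a x) (l1w_scal a y).
Proof. apply l1w_eq; intros n; apply Cmult_plus_distr_l. Qed.

Lemma l1w_scal_distr_r (a b : C_Ring) (x : l1w_AbelianGroup) :
  l1w_scal (plus a b) x = plus (l1w_scal a x) (l1w_scal b x).
Proof. apply l1w_eq; intros n; apply Cmult_plus_distr_r. Qed.

Definition l1w_ModuleSpace_mixin :=
  ModuleSpace.Mixin C_Ring l1w_AbelianGroup l1w_scal
    l1w_scal_assoc l1w_scal_one l1w_scal_distr_l l1w_scal_distr_r.

Canonical l1w_ModuleSpace :=
  ModuleSpace.Pack C_Ring l1w
    (ModuleSpace.Class _ _ (AbelianGroup.class l1w_AbelianGroup)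
       l1w_ModuleSpace_mixin) l1w.

Definition l1w_norm (x : l1w) : R := norm_l1w w (coord x).

Definition l1w_ball (x : l1w) (eps : R) (y : l1w) : Prop :=
  l1w_norm (minus y x) < eps.

Lemma l1w_norm_triangle (x y : l1w) :
  l1w_norm (plus x y) <= l1w_norm x + l1w_norm y.
Proof.
unfold l1w_norm, norm_l1w, coord.
rewrite <- (Series_plus _ _ (proj2_sig x) (proj2_sig y)).
apply Series_le.
  intros n; split; [apply wterm_ge0 | apply wterm_triangle].
exact (ex_series_plus _ _ (proj2_sig x) (proj2_sig y)).
Qed.

Lemma l1w_norm_scal (a : C) (x : l1w) :
  l1w_norm (l1w_scal a x) = Cmod a * l1w_norm x.
Proof.
unfold l1w_norm, norm_l1w. rewrite <- Series_scal_l.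
apply Series_ext; intros n; unfold coord; simpl; rewrite Cmod_mult; ring.
Qed.

Lemma l1w_norm_opp (x : l1w) : l1w_norm (opp x) = l1w_norm x.
Proof.
unfold l1w_norm, norm_l1w.
apply Series_ext; intros n; unfold coord; simpl; now rewrite Cmod_opp.
Qed.

Lemma l1w_norm_eq_zero (x : l1w) : l1w_norm x = 0 -> x = zero.
Proof.
intros H; apply l1w_eq; intros n; apply Cmod_eq_0.
apply (Rmult_eq_reg_l (w n)); [| apply Rgt_not_eq, wt_pos].
rewrite Rmult_0_r; apply Rle_antisym; [| apply wterm_ge0].
rewrite <- H.
set (u := fun k => w k * Cmod (coord x k)).
apply Rle_trans with (sum_n u n).
  destruct n as [|n]; [rewrite sum_O; apply Rle_refl |].
  rewrite sum_Sn; change (u (S n) <= sum_n u n + u (S n)).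
  cut (0 <= sum_n u n); [lra |].
  rewrite sum_n_Reals; apply cond_pos_sum; intros k; apply wterm_ge0.
apply (is_lim_seq_incr_compare (sum_n u) (l1w_norm x)).
  exact (Series_correct _ (proj2_sig x)).
intros k; rewrite sum_Sn; change (sum_n u k <= sum_n u k + u (S k)).
assert (0 <= u (S k)) by apply wterm_ge0; lra.
Qed.

Lemma l1w_ball_center (x : l1w) (e : posreal) : l1w_ball x e x.
Proof.
unfold l1w_ball; rewrite minus_eq_zero.
change (l1w_norm l1w_zero < e).
replace (l1w_norm l1w_zero) with 0; [apply cond_pos |].
unfold l1w_norm, norm_l1w; symmetry.
rewrite <- (Rmult_0_l (Series w)), <- Series_scal_l.
apply Series_ext; intros n; unfold coord; simpl; rewrite Cmod_0; ring.
Qed.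

Lemma l1w_ball_sym (x y : l1w) (e : R) : l1w_ball x e y -> l1w_ball y e x.
Proof.
unfold l1w_ball; intros H.
now rewrite <- opp_minus, l1w_norm_opp.
Qed.

Lemma l1w_ball_triangle (x y z : l1w) (e1 e2 : R) :
  l1w_ball x e1 y -> l1w_ball y e2 z -> l1w_ball x (e1 + e2) z.
Proof.
unfold l1w_ball; intros H1 H2.
rewrite (minus_trans y z x).
apply Rle_lt_trans with (1 := l1w_norm_triangle _ _); lra.
Qed.

Definition l1w_UniformSpace_mixin :=
  UniformSpace.Mixin l1w l1w_zero l1w_ball
    l1w_ball_center l1w_ball_sym l1w_ball_triangle.

Canonical l1w_UniformSpace := UniformSpace.Pack l1w l1w_UniformSpace_mixin l1w.

Canonical l1w_NormedModuleAux :=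
  NormedModuleAux.Pack C_AbsRing l1w
    (NormedModuleAux.Class C_AbsRing _ (ModuleSpace.class _ l1w_ModuleSpace)
       l1w_UniformSpace_mixin) l1w.

Lemma l1w_norm_scal_le (a : C_AbsRing) (x : l1w_NormedModuleAux) :
  l1w_norm (scal a x) <= abs a * l1w_norm x.
Proof. apply Req_le, l1w_norm_scal. Qed.

Lemma l1w_norm_ball (x y : l1w_NormedModuleAux) (eps : R) :
  l1w_norm (minus y x) < eps -> ball x eps y.
Proof. trivial. Qed.

Lemma l1w_ball_norm (x y : l1w_NormedModuleAux) (eps : posreal) :
  ball x eps y -> l1w_norm (minus y x) < 1 * eps.
Proof. now rewrite Rmult_1_l. Qed.

Definition l1w_NormedModule_mixin :=
  NormedModule.Mixin C_AbsRing l1w_NormedModuleAux l1w_norm 1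
    l1w_norm_triangle l1w_norm_scal_le l1w_norm_ball l1w_ball_norm
    l1w_norm_eq_zero.

Canonical l1w_NormedModule :=
  NormedModule.Pack C_AbsRing l1w
    (NormedModule.Class _ _ (NormedModuleAux.class _ l1w_NormedModuleAux)
       l1w_NormedModule_mixin) l1w.

End WeightedL1.

Section Operators.

Context {X : NormedModule C_AbsRing}.

Definition continuous_linear (T : X -> X) : Prop :=
  (forall x y, T (plus x y) = plus (T x) (T y)) /\
  (forall (a : C) x, T (scal a x) = scal a (T x)) /\
  (forall x, continuous T x).

Definition op_norm (T : X -> X) : Rbar :=
  Lub_Rbar (fun r => exists x : X, norm x <= 1 /\ r = norm (T x)).

Definition op_pow (T : X -> X) (n : nat) : X -> X := Nat.iter n T.

(* T_[n]; meaningful for n >= 1 only. *)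
Definition op_mean (T : X -> X) (n : nat) : X -> X := fun x =>
  scal (RtoC (/ INR n)) (sum_n_m (fun m => op_pow T m x) 1 n).

Definition power_bounded (T : X -> X) : Prop :=
  Rbar_lt (Sup_seq (fun n => op_norm (op_pow T (S n)))) p_infty.

Definition cesaro_bounded (T : X -> X) : Prop :=
  Rbar_lt (Sup_seq (fun n => op_norm (op_mean T (S n)))) p_infty.

Definition mean_ergodic (T : X -> X) : Prop :=
  exists P : X -> X, continuous_linear P /\
    forall x, filterlim (fun n => op_mean T n x) eventually (locally (P x)).

End Operators.

Definition cesaro (x : nat -> C) : nat -> C := fun n =>
  Cdiv (sum_n x n) (RtoC (INR (S n))).

Definition cesaro_l1w (w : weight)
    (hC : forall x, in_l1w w x -> in_l1w w (cesaro x)) (x : l1w w) : l1w w :=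
  exist _ (cesaro (coord w x)) (hC (coord w x) (proj2_sig x)).

(* Main.v *)
(** The iterates of the Cesàro operator on a positive multiple [a e_1] of the
    first unit vector are non-negative, increase coordinatewise and are bounded
    by [a]; their limit is a fixed vector of the Cesàro operator with first
    coordinate [a], hence constantly [a].  Their arithmetic means
    therefore also converge coordinatewise to [a].  Any norm bound for the iterates or for
    the means then passes, by Fatou, to the constant vector [a], which says
    that the weight is summable.  For mean ergodicity the bound comes from the
    convergence at [a e_1] alone, without uniform boundedness. *)

Require Import Defs.
From Stdlib Require Import Reals.
From Coquelicot Require Import Coquelicot.
From Stdlib Require Import Lra Lia.

(** * Norm bounds along a single orbit *)

Lemma bounded_orbit_of_bounded_op_norms {X : NormedModule C_AbsRing}
  (A : nat -> X -> X) (x : X) :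
  Rbar_lt (Sup_seq (fun k => op_norm (A k))) p_infty -> norm x <= 1 ->
  exists K, forall k, norm (A k x) <= K.
Proof.
intros HA Hx.
assert (H : forall k, Rbar_le (norm (A k x)) (Sup_seq (fun k => op_norm (A k)))).
{ intros k. apply (Sup_seq_minor_le _ _ k).
  apply (proj1 (Lub_Rbar_correct (fun r => exists x : X, norm x <= 1 /\ r = norm (A k x)))).
  exists x; split; [exact Hx | reflexivity]. }
(* A finite supremum is the wanted bound; [p_infty] contradicts [HA], and [m_infty] cannot lie above
   a norm. *)
destruct (Sup_seq (fun k => op_norm (A k))) as [K| |]; simpl in *.
- exists K; exact H.
- contradiction.
- destruct (H 0%nat).
Qed.

(** From some index on the terms lie within distance 1 of [l]. An eventual bound is all that the
    Fatou argument below asks for. *)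
Lemma bounded_of_filterlim {X : NormedModule C_AbsRing} (y : nat -> X) (l : X) :
  filterlim y eventually (locally l) ->
  exists K, eventually (fun k => norm (y k) <= K).
Proof.
intros Hy. exists (norm l + 1).
apply (filter_imp (fun k => norm (minus (y k) l) < 1)).
- intros k Hk.
  replace (y k) with (plus l (minus (y k) l)).
  + apply Rle_trans with (1 := norm_triangle _ _); lra.
  + unfold minus. rewrite (plus_comm (y k)), plus_assoc.
    transitivity (plus zero (y k)); [|apply plus_zero_l].
    exact (f_equal (fun z => plus z (y k)) (plus_opp_r l)).
- apply (Hy (fun z => norm (minus z l) < 1)).
  apply locally_le_locally_norm. exists (mkposreal 1 Rlt_0_1).
  intros z Hz; exact Hz.
Qed.

(** * Fatou's argument in the weighted space *)

Lemma partial_sum_le_norm (w : weight) (x : l1w w) (N : nat) :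
  sum_n (fun n => w n * Cmod (coord w x n)) N <= l1w_norm w x.
Proof.
apply (is_lim_seq_incr_compare (sum_n (fun n => w n * Cmod (coord w x n)))
         (l1w_norm w x)).
- exact (Series_correct _ (proj2_sig x)).
- intros k; rewrite sum_Sn; unfold plus; simpl.
  pose proof (wterm_ge0 w (coord w x) (S k)); lra.
Qed.

Lemma is_lim_seq_sum_n (v : nat -> nat -> R) (l : nat -> R) (N : nat) :
  (forall n, is_lim_seq (fun k => v k n) (l n)) ->
  is_lim_seq (fun k => sum_n (v k) N) (sum_n l N).
Proof.
intros Hv; induction N as [|N IH].
- rewrite sum_O. apply is_lim_seq_ext with (2 := Hv 0%nat).
  intros k; now rewrite sum_O.
- rewrite sum_Sn.
  apply is_lim_seq_ext with (fun k => sum_n (v k) N + v k (S N)).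
  + intros k; now rewrite sum_Sn.
  + now apply (is_lim_seq_plus' _ _ _ _ IH).
Qed.

(** Fatou by hand: each finite partial sum of the norms is at most [K] and passes to the limit in
    [k]. The partial sums of [w n * a] are thus increasing and bounded, and dividing by [a] gives
    summability of [w]. *)
Lemma weight_summable_of_bounded (w : weight) (y : nat -> l1w w) (a K : R) :
  0 < a ->
  (forall n, is_lim_seq (fun k => Cmod (coord w (y k) n)) a) ->
  eventually (fun k => l1w_norm w (y k) <= K) ->
  in_l1 w.
Proof.
intros Ha Hy HK.
assert (Hb : forall N, sum_n (fun n => w n * a) N <= K).
{ intros N.
  apply (is_lim_seq_le_loc (fun k => sum_n (fun n => w n * Cmod (coord w (y k) n)) N)
           (fun _ => K) (sum_n (fun n => w n * a) N) K).
  - apply (filter_imp (fun k => l1w_norm w (y k) <= K)); [|exact HK].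
    intros k Hk; apply Rle_trans with (2 := Hk); apply partial_sum_le_norm.
  - apply (is_lim_seq_sum_n (fun k n => w n * Cmod (coord w (y k) n))).
    intros n; exact (is_lim_seq_scal_l _ (w n) _ (Hy n)).
  - apply is_lim_seq_const. }
assert (Hs : ex_series (fun n => w n * a)).
{ apply ex_finite_lim_seq_incr with (2 := Hb).
  intros n; rewrite sum_Sn; unfold plus; simpl.
  pose proof (Rmult_lt_0_compat _ _ (wt_pos w (S n)) Ha); lra. }
apply ex_series_ext with (fun n => / a * (w n * a)).
- intros n. rewrite Cmod_R, Rabs_pos_eq by apply Rlt_le, wt_pos.
  change (/ a * (w n * a) = 1 * w n); field; lra.
- exact (ex_series_scal_l (/ a) _ Hs).
Qed.

(** * Real coordinates of the orbit of $a e_1$ and their limits *)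

Definition spike (a : R) (n : nat) : R := match n with 0 => a | _ => 0 end.

(** The iterates are modelled over the reals, where order and monotone limits are available;
    [coord_cesaro_pow] links them to the operator. *)
Fixpoint cesaro_orbit (a : R) (m n : nat) : R :=
  match m with
  | 0 => spike a n
  | S m => sum_n (cesaro_orbit a m) n / INR (S n)
  end.

Lemma INR_S_pos n : 0 < INR (S n).
Proof. apply lt_0_INR; lia. Qed.

Lemma cesaro_orbit_0 a m : cesaro_orbit a m 0 = a.
Proof.
induction m as [|m IH]; [reflexivity|].
simpl; rewrite sum_O, IH; apply Rdiv_1_r.
Qed.

Lemma cesaro_orbit_bounds a m n : 0 <= a -> 0 <= cesaro_orbit a m n <= a.
Proof.
intros Ha; revert n; induction m as [|m IH]; intros n.
- destruct n; simpl; lra.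
- simpl cesaro_orbit. pose proof (INR_S_pos n) as Hn.
  assert (0 <= sum_n (cesaro_orbit a m) n) by
    (rewrite sum_n_Reals; apply cond_pos_sum; intros k; apply IH).
  assert (sum_n (cesaro_orbit a m) n <= a * INR (S n)).
  { rewrite Rmult_comm, <- sum_n_const. rewrite !sum_n_Reals.
    apply sum_Rle; intros k _; apply IH. }
  split; [apply Rdiv_le_0_compat; assumption | apply Rle_div_l; assumption].
Qed.

(** Averaging preserves the order, so only the first step matters: there coordinate 0 is unchanged
    and the others start from 0. *)
Lemma cesaro_orbit_incr a m n :
  0 <= a -> cesaro_orbit a m n <= cesaro_orbit a (S m) n.
Proof.
intros Ha; revert n; induction m as [|m IH]; intros n.
- destruct n as [|n].
  + rewrite !cesaro_orbit_0; lra.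
  + apply (cesaro_orbit_bounds a 1 (S n) Ha).
- change (sum_n (cesaro_orbit a m) n / INR (S n)
          <= sum_n (cesaro_orbit a (S m)) n / INR (S n)).
  apply Rmult_le_compat_r; [apply Rlt_le, Rinv_0_lt_compat, INR_S_pos|].
  rewrite !sum_n_Reals; apply sum_Rle; intros k _; apply IH.
Qed.

Lemma cesaro_fixed_constant (l : nat -> R) :
  (forall n, l n = sum_n l n / INR (S n)) -> forall n, l n = l 0%nat.
Proof.
intros Hl.
assert (Hs : forall n, sum_n l n = INR (S n) * l n).
{ intros n; rewrite (Hl n), Rmult_div_assoc, Rmult_div_r; [reflexivity|].
  apply Rgt_not_eq, INR_S_pos. }
induction n as [|n IH]; [reflexivity|].
rewrite <- IH.
(* Comparing the sums up to [n] and [S n] leaves [INR (S n) * l n = INR (S n) * l (S n)]. *)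
pose proof (Hs (S n)) as H; rewrite sum_Sn, Hs, (S_INR (S n)) in H.
apply (Rmult_eq_reg_l (INR (S n))); [|apply Rgt_not_eq, INR_S_pos].
change (INR (S n) * l n + l (S n) = (INR (S n) + 1) * l (S n)) in H. lra.
Qed.

(** Monotone convergence gives limits [l]. Letting [m] tend to infinity in the recursion, which
    involves only finite sums, makes [l] a fixed vector, hence constant, and its coordinate 0 is
    [a]. *)
Lemma cesaro_orbit_lim a n :
  0 <= a -> is_lim_seq (fun m => cesaro_orbit a m n) a.
Proof.
intros Ha.
set (l := fun n => real (Lim_seq (fun m => cesaro_orbit a m n))).
assert (Hl : forall n, is_lim_seq (fun m => cesaro_orbit a m n) (l n)).
{ intros k; apply Lim_seq_correct'.
  apply (ex_finite_lim_seq_incr _ a).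
  - intros m; now apply cesaro_orbit_incr.
  - intros m; now apply cesaro_orbit_bounds. }
assert (Hfix : forall n, l n = sum_n l n / INR (S n)).
{ intros k.
  assert (H : is_lim_seq (fun m => cesaro_orbit a (S m) k)
                (sum_n l k / INR (S k))).
  { apply (is_lim_seq_scal_r _ (/ INR (S k)) (sum_n l k)).
    now apply is_lim_seq_sum_n. }
  apply is_lim_seq_unique in H.
  pose proof (is_lim_seq_unique _ _ (proj1 (is_lim_seq_incr_1 _ _) (Hl k))) as H'.
  rewrite H' in H. now injection H. }
assert (Hla : l n = a); [|pose proof (Hl n) as H; now rewrite Hla in H].
rewrite (cesaro_fixed_constant l Hfix n).
unfold l; rewrite (Lim_seq_ext _ (fun _ => a)), Lim_seq_const; [reflexivity|].
intros m; apply cesaro_orbit_0.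
Qed.

Lemma is_lim_seq_mean (u : nat -> R) (l : R) :
  is_lim_seq u l ->
  is_lim_seq (fun k => / INR (S k) * sum_n_m u 1 (S k)) l.
Proof.
intros Hu.
(* The shift is needed because the means start at the first power, not at the identity. The shift
   after it discards the mean of index 0. *)
apply is_lim_seq_incr_1, is_lim_seq_Reals, Cesaro_1 in Hu.
apply is_lim_seq_Reals, is_lim_seq_incr_1 in Hu.
apply is_lim_seq_ext with (2 := Hu).
intros k; simpl pred. rewrite <- sum_n_Reals.
unfold sum_n; rewrite sum_n_m_S. apply Rmult_comm.
Qed.

(** * Coordinates of the iterates and means of the operator *)

Lemma RtoC_sum_n_m (u : nat -> R) p q :
  sum_n_m (fun n => RtoC (u n)) p q = RtoC (sum_n_m u p q).
Proof.
unfold sum_n_m, Iter.iter_nat.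
induction (seq.iota p (S q - p)) as [|k s IH]; [reflexivity|].
exact (eq_trans (f_equal (Cplus (RtoC (u k))) IH) (eq_sym (RtoC_plus _ _))).
Qed.

Lemma coord_sum_n_m (w : weight) (y : nat -> l1w w) p q n :
  coord w (sum_n_m y p q) n = sum_n_m (fun k => coord w (y k) n) p q.
Proof.
unfold sum_n_m, Iter.iter_nat.
induction (seq.iota p (S q - p)) as [|k s IH]; [reflexivity|].
exact (f_equal (Cplus (coord w (y k) n)) IH).
Qed.

Lemma is_series_spike (w : weight) (a : R) :
  0 <= a -> is_series (fun n => w n * Cmod (RtoC (spike a n))) (w 0%nat * a).
Proof.
intros Ha.
apply (is_lim_seq_ext (fun _ => w 0%nat * a) _ (w 0%nat * a));
  [|apply is_lim_seq_const].
induction n as [|n IH].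
- rewrite sum_O; simpl. now rewrite Cmod_R, Rabs_pos_eq.
- rewrite sum_Sn, <- IH; unfold plus; simpl. rewrite Cmod_0; ring.
Qed.

Definition l1w_spike (w : weight) (a : R) (Ha : 0 <= a) : l1w w :=
  exist _ (fun n => RtoC (spike a n)) (ex_intro _ _ (is_series_spike w a Ha)).

Lemma coord_cesaro_pow (w : weight)
  (hC : forall x : nat -> C, in_l1w w x -> in_l1w w (cesaro x)) a Ha m n :
  coord w (op_pow (cesaro_l1w w hC) m (l1w_spike w a Ha)) n =
  RtoC (cesaro_orbit a m n).
Proof.
revert n; induction m as [|m IH]; intros n; [reflexivity|].
change (cesaro (coord w (op_pow (cesaro_l1w w hC) m (l1w_spike w a Ha))) n
        = RtoC (sum_n (cesaro_orbit a m) n / INR (S n))).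
unfold cesaro. rewrite (sum_n_ext _ _ _ IH).
unfold sum_n; rewrite RtoC_sum_n_m.
now rewrite RtoC_div by apply Rgt_not_eq, INR_S_pos.
Qed.

Lemma coord_cesaro_mean (w : weight)
  (hC : forall x : nat -> C, in_l1w w x -> in_l1w w (cesaro x)) a Ha k n :
  coord w (op_mean (cesaro_l1w w hC) k (l1w_spike w a Ha)) n =
  RtoC (/ INR k * sum_n_m (fun m => cesaro_orbit a m n) 1 k).
Proof.
unfold op_mean. rewrite RtoC_mult, <- RtoC_sum_n_m.
change (Cmult (RtoC (/ INR k))
  (coord w (sum_n_m (fun m => op_pow (cesaro_l1w w hC) m (l1w_spike w a Ha)) 1 k) n) =
  Cmult (RtoC (/ INR k)) (sum_n_m (fun m => RtoC (cesaro_orbit a m n)) 1 k)).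
f_equal. rewrite coord_sum_n_m. apply sum_n_m_ext; intros m.
apply coord_cesaro_pow.
Qed.

Lemma is_lim_seq_Cmod_RtoC (z : nat -> C) (u : nat -> R) (a : R) :
  (forall k, z k = RtoC (u k)) -> 0 <= a -> is_lim_seq u a ->
  is_lim_seq (fun k => Cmod (z k)) a.
Proof.
intros Hz Ha Hu.
apply is_lim_seq_ext with (fun k => Rabs (u k)).
- intros k; now rewrite Hz, Cmod_R.
- rewrite <- (Rabs_pos_eq a Ha). exact (is_lim_seq_abs _ _ Hu).
Qed.

Theorem lemma4p2 (w : weight)
  (hC : forall x : nat -> C, in_l1w w x -> in_l1w w (cesaro x))
  (hL : continuous_linear (cesaro_l1w w hC)) :
  (cesaro_bounded (cesaro_l1w w hC) -> in_l1 w) /\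
  (power_bounded (cesaro_l1w w hC) \/ mean_ergodic (cesaro_l1w w hC) ->
   in_l1 w).
Proof.
clear hL.
(* This choice gives $a e_1$ norm exactly 1, so it is admissible in the supremum defining
   [op_norm]. *)
set (a := / w 0%nat).
assert (Ha : 0 < a) by apply Rinv_0_lt_compat, wt_pos.
set (x := l1w_spike w a (Rlt_le _ _ Ha) : l1w_NormedModule w).
set (T := cesaro_l1w w hC : l1w_NormedModule w -> l1w_NormedModule w).
assert (Hx : norm x <= 1).
{ change (Series (fun n => w n * Cmod (RtoC (spike a n))) <= 1).
  rewrite (is_series_unique _ _ (is_series_spike w a (Rlt_le _ _ Ha))).
  unfold a; rewrite Rinv_r; [lra | apply Rgt_not_eq, wt_pos]. }
assert (Hpow : forall n,
  is_lim_seq (fun k => Cmod (coord w (op_pow T (S k) x) n)) a).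
{ intros n.
  apply (is_lim_seq_Cmod_RtoC _ (fun k => cesaro_orbit a (S k) n)); [|lra|].
  - intros k; apply coord_cesaro_pow.
  - apply (is_lim_seq_incr_1 (fun k => cesaro_orbit a k n)), cesaro_orbit_lim; lra. }
assert (Hmean : forall n,
  is_lim_seq (fun k => Cmod (coord w (op_mean T (S k) x) n)) a).
{ intros n.
  apply (is_lim_seq_Cmod_RtoC _
    (fun k => / INR (S k) * sum_n_m (fun m => cesaro_orbit a m n) 1 (S k))); [|lra|].
  - intros k; apply coord_cesaro_mean.
  - apply is_lim_seq_mean, cesaro_orbit_lim; lra. }
split; [intros H | intros [H | [P [_ H]]]].
- destruct (bounded_orbit_of_bounded_op_norms _ x H Hx) as [K HK].
  apply (weight_summable_of_bounded w _ a K Ha Hmean).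
  exists 0%nat; intros k _; apply HK.
- destruct (bounded_orbit_of_bounded_op_norms _ x H Hx) as [K HK].
  apply (weight_summable_of_bounded w _ a K Ha Hpow).
  exists 0%nat; intros k _; apply HK.
(* The convergent means are indexed by [n], those in [Hmean] by [S k]; [k >= N] still gives
   [S k >= N]. *)
- destruct (bounded_of_filterlim _ _ (H x)) as [K [N HN]].
  apply (weight_summable_of_bounded w _ a K Ha Hmean).
  exists N; intros k Hk; apply (HN (S k)); lia.
Qed.
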